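(* Let $(\Omega,T)$ be a minimal, uniquely ergodic subshift over a finite alphabet that satisfies the leading sequence condition (LSC). Then every locally constant function $A:\Omega\to SL(2,\mathbb{R})$ is uniform, i.e. the limit $\lim_{n\to\infty}\frac1n\log\|A(n,\omega)\|$ exists for all $\omega\in\Omega$ and the convergence is uniform on $\Omega$ (to a single number $\Lambda$).
   Context: Let $\mathcal{A}$ be a finite set (alphabet). A subshift $(\Omega,T)$ over $\mathcal{A}$ consists of a closed subset $\Omega\subset\mathcal{A}^{\mathbb{Z}}$ (product topology) invariant under the shift $(Ts)(n)=s(n+1)$. It is minimal if $\{T^n\omega:n\in\mathbb{Z}\}$ is dense in $\Omega$ for every $\omega\in\Omega$, and uniquely ergodic if there is exactly one $T$-invariant Borel probability measure on $\Omega$. $\mathcal{W}(\Omega)_n$ denotes the set of all words $\omega(k)\ldots\omega(k+n-1)$ with $\omega\in\Omega$, $k\in\mathbb{Z}$. A function $A$ on $\Omega$ is locally constant if there is $N\in\mathbb{N}$ such that $A(\omega)=A(\varrho)$ whenever $\omega(-N)\ldots\omega(N)=\varrho(-N)\ldots\varrho(N)$. For $A:\Omega\to SL(2,\mathbb{R})$ the cocycle is $A(n,\omega)=A(T^{n-1}\omega)\cdots A(\omega)$ for $n>0$, $A(0,\omega)=\mathrm{Id}$, and $A(n,\omega)=A(T^{n}\omega)^{-1}\cdots A(T^{-1}\omega)^{-1}$ for $n<0$. $\|\cdot\|$ is the operator norm induced by the Euclidean norm on $\mathbb{R}^2$. Leading sequence condition (LSC): there exist $r\in\mathbb{N}$ and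 $\omega^{(1)},\ldots,\omega^{(r)}\in\Omega$ (the leading sequences) such that: ($\alpha$) there is $N\in\mathbb{N}$ with $\mathcal{W}(\Omega)_n=\bigcup_{j=1}^r\{\omega^{(j)}(-k+1)\ldots\omega^{(j)}(-k+n):k=0,\ldots,n\}$ for all $n\ge N$; and for every locally constant $A:\Omega\to SL(2,\mathbb{R})$: ($\beta$) for every $j$ the limits $\lim_{n\to\infty}\frac{\log\|A(n,\omega^{(j)})\|}{|n|}$ and $\lim_{n\to-\infty}\frac{\log\|A(n,\omega^{(j)})\|}{|n|}$ exist, and all these limits (over all $j$ and both signs) have the same value; ($\gamma$) for every $j$ and every $v\in\mathbb{R}^2\setminus\{0\}$, at most one of the two limits $\lim_{n\to\pm\infty}\frac1{|n|}\log\|A(n,\omega^{(j)})v\|$ is negative (i.e. it is not the case that both limits exist and are negative). *)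

(* Defs.v *)
From HB Require Import structures.
From mathcomp Require Import all_boot all_order all_algebra.
From mathcomp Require Import all_classical all_reals all_analysis.
Set Implicit Arguments.
Unset Strict Implicit.
Unset Printing Implicit Defensive.
Import Order.TTheory GRing.Theory Num.Theory numFieldNormedType.Exports.
Local Open Scope classical_set_scope.
Local Open Scope ring_scope.

Definition fullshift (A : finType) : Type := {ptws int -> discrete_topology A}.

Definition shift (A : finType) (s : fullshift A) : fullshift A :=
  fun n => s (n + 1).

(* Invariance is meant two-sidedly (T Omega = Omega), so that T is a bijection
   of Omega and all powers T^n, n in Z, act on Omega. *)
Record subshift (A : finType) := Subshift {
  points :> set (fullshift A);
  points_closed : closed points;
  points_invariant : @shift A @` points = points }.

Definition seq_of (A : finType) (Om : subshift A) (w : Om) : fullshift A :=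
  set_val w.

Definition shiftz (A : finType) (k : int) (s : fullshift A) : fullshift A :=
  fun n => s (n + k).

Lemma shift_inj (A : finType) : injective (@shift A).
Proof.
move=> s t st; apply/funext => n.
by have := congr1 (@^~ (n - 1)) st; rewrite /shift subrK.
Qed.

Lemma shiftzS (A : finType) (k : int) (s : fullshift A) :
  shiftz (k + 1) s = shift (shiftz k s).
Proof.
by apply/funext => n; rewrite /shift /shiftz -addrA [1 + k]addrC.
Qed.

Lemma shiftz0 (A : finType) (s : fullshift A) : shiftz 0 s = s.
Proof. by apply/funext => n; rewrite /shiftz addr0. Qed.

Lemma shift_points (A : finType) (Om : subshift A) (s : fullshift A) :
  points Om (shift s) <-> points Om s.
Proof.
split=> [|Os]; last by rewrite -points_invariant; exists s.
by rewrite -{1}points_invariant => -[t Ot /shift_inj <-].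
Qed.

Lemma shiftz_points (A : finType) (Om : subshift A) (k : int) (w : Om) :
  shiftz k (seq_of w) \in points Om.
Proof.
apply/mem_set; elim: k => [|n IHn|n IHn].
- by rewrite shiftz0; exact: set_valP.
- by rewrite -addn1 PoszD shiftzS; apply/shift_points.
- by apply/shift_points; rewrite -shiftzS -addn1 PoszD opprD subrK.
Qed.

(* T^k acting on Omega *)
Definition Tpow (A : finType) (Om : subshift A) (k : int) (w : Om) : Om :=
  exist _ (shiftz k (seq_of w)) (shiftz_points k w).

Definition minimal (A : finType) (Om : subshift A) : Prop :=
  forall w : Om, dense (range (fun n : int => Tpow n w)).

(* Measurable types are required to be pointed, whence the parameter x0, which
   does not affect the Borel sets. *)
Definition pointed_space (A : finType) (Om : subshift A) (x0 : Om) : Type := Om.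

HB.instance Definition _ (A : finType) (Om : subshift A) (x0 : Om) :=
  Topological.copy (pointed_space x0) Om.
HB.instance Definition _ (A : finType) (Om : subshift A) (x0 : Om) :=
  isPointed.Build (pointed_space x0) x0.

Definition borel (A : finType) (Om : subshift A) (x0 : Om) :=
  g_sigma_algebraType (@open (pointed_space x0)).

Definition shift_invariant (R : realType) (A : finType) (Om : subshift A)
    (x0 : Om) (mu : probability (borel x0) R) : Prop :=
  forall B : set (borel x0), measurable B ->
    mu ((fun w : Om => Tpow 1 w) @^-1` B) = mu B.

Definition uniquely_ergodic (R : realType) (A : finType) (Om : subshift A) :
    Prop :=
  exists (x0 : Om) (mu : probability (borel x0) R),
    shift_invariant mu /\
    forall nu : probability (borel x0) R, shift_invariant nu ->
      forall B : set (borel x0), measurable B -> nu B = mu B.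

(* word s k n is s(k) ... s(k+n-1) *)
Definition word (A : finType) (s : fullshift A) (k : int) (n : nat) :
    n.-tuple A :=
  [tuple s (k + (i : nat)%:Z) | i < n].

Definition language (A : finType) (Om : subshift A) (n : nat) :
    set (n.-tuple A) :=
  [set u | exists (w : Om) (k : int), u = word (seq_of w) k n].

Arguments language {A} Om n.

Definition locally_constant (A : finType) (Om : subshift A) (Y : Type)
    (M : Om -> Y) : Prop :=
  exists N : nat, forall w v : Om,
    (forall i : int, - N%:Z <= i <= N%:Z -> seq_of w i = seq_of v i) ->
    M w = M v.

Definition eucl_norm (R : realType) (v : 'cV[R]_2) : R :=
  Num.sqrt (\sum_i v i 0 ^+ 2).

Definition op_norm (R : realType) (M : 'M[R]_2) : R :=
  sup [set eucl_norm (M *m v) | v in [set v | eucl_norm v = 1]].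

Definition SL2_valued (R : realType) (X : Type) (M : X -> 'M[R]_2) : Prop :=
  forall x, \det (M x) = 1.

(* For n > 0 the product reads M(T^(n-1) w) * ... * M(w), as rev_ord i is
   n - 1 - i; Negz n is -(n+1), and its product reads
   M(T^(-(n+1)) w)^-1 * ... * M(T^(-1) w)^-1. *)
Definition cocycle (R : realType) (A : finType) (Om : subshift A)
    (M : Om -> 'M[R]_2) (n : int) (w : Om) : 'M[R]_2 :=
  match n with
  | Posz n => \prod_(i < n) M (Tpow (rev_ord i : nat)%:Z w)
  | Negz n => \prod_(i < n.+1) (M (Tpow (- (rev_ord i).+1%:Z) w))^-1
  end.

Record leading_sequence_condition (R : realType) (A : finType)
    (Om : subshift A) (r : nat) (lead : 'I_r -> Om) : Prop := {
  LSC_alpha : exists N : nat, forall n : nat, (N <= n)%N ->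
    language Om n = \bigcup_(j in [set: 'I_r])
      [set word (seq_of (lead j)) (- k%:Z + 1) n | k in [set k | (k <= n)%N]];
  LSC_beta : forall M : Om -> 'M[R]_2, SL2_valued M -> locally_constant M ->
    exists L : R, forall j : 'I_r,
      (fun n : nat => ln (op_norm (cocycle M n%:Z (lead j))) / n%:R)
        @ \oo --> L /\
      (fun n : nat => ln (op_norm (cocycle M (- n%:Z) (lead j))) / n%:R)
        @ \oo --> L;
  LSC_gamma : forall M : Om -> 'M[R]_2, SL2_valued M -> locally_constant M ->
    forall (j : 'I_r) (v : 'cV[R]_2), v != 0 ->
      ~ exists a b : R, [/\ a < 0, b < 0,
        (fun n : nat => ln (eucl_norm (cocycle M n%:Z (lead j) *m v)) / n%:R)
          @ \oo --> a &
        (fun n : nat => ln (eucl_norm (cocycle M (- n%:Z) (lead j) *m v)) / n%:R)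
          @ \oo --> b] }.

Definition LSC (R : realType) (A : finType) (Om : subshift A) : Prop :=
  exists (r : nat) (lead : 'I_r -> Om), leading_sequence_condition R lead.

Definition uniform_cocycle (R : realType) (A : finType) (Om : subshift A)
    (M : Om -> 'M[R]_2) : Prop :=
  exists Lambda : R,
    {uniform, (fun (n : nat) (w : Om) =>
                 ln (op_norm (cocycle M n%:Z w)) / n%:R) @ \oo
              --> (fun _ : Om => Lambda)}.

(* Main.v *)
(* Let f(q) be the cocycle along a leading sequence, q in Z, and let L be the
   common rate of (beta).  If L > 0, the deterministic part of Oseledets' theorem
   provides directions v+ and v- contracted at rate L at +oo and at -oo, and
   (gamma) says that they differ; hence v- grows at rate L along the whole line:
   |f(q) v-| ~ e^(L q) both for q -> +oo and for q -> -oo.  By (alpha) the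
   cocycle A(n, w) over any window is f(n + p) f(p)^-1 for a window [p, p + n)
   which meets the origin up to a bounded error.  Submultiplicativity bounds
   log |A(n, w)| above by L (|n + p| + |p|) + o(n) = L n + o(n), and the image of
   f(p) v- bounds it below by L n - o(n).  If L = 0, the lower bound is |A| >= 1. *)

Require Import Defs.
From mathcomp Require Import all_boot all_order all_algebra.
From mathcomp Require Import all_classical all_reals all_analysis.
From mathcomp Require Import zify ring lra.
Set Implicit Arguments.
Unset Strict Implicit.
Unset Printing Implicit Defensive.
Import Order.TTheory GRing.Theory Num.Theory numFieldNormedType.Exports.
Local Open Scope classical_set_scope.
Local Open Scope ring_scope.

(* The Frobenius norm; on SL(2, R) it turns every estimate below into a polynomial
   identity, and it agrees with op_norm up to a factor 2. *)
Definition frob (R : realType) (M : 'M[R]_2) : R :=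
  Num.sqrt (\sum_i \sum_j M i j ^+ 2).

(** * Entrywise formulas for 2 x 2 matrices *)

Lemma sum_ord2 (V : nmodType) (F : 'I_2 -> V) : \sum_i F i = F 0 + F 1.
Proof. by rewrite big_ord_recl big_ord1; congr (_ + F _); apply/val_inj. Qed.

Lemma forall_ord2 (P : 'I_2 -> Prop) : P 0 -> P 1 -> forall i, P i.
Proof.
move=> P0 P1 [[|[|//]] lt_i2].
- by rewrite (_ : Ordinal _ = 0) //; apply/val_inj.
- by rewrite (_ : Ordinal _ = 1) //; apply/val_inj.
Qed.

Lemma mulmx2E (R : pzRingType) m n (M : 'M[R]_(m, 2)) (N : 'M[R]_(2, n)) i j :
  (M *m N) i j = M i 0 * N 0 j + M i 1 * N 1 j.
Proof. by rewrite mxE sum_ord2. Qed.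

Lemma mul2E (R : nzRingType) (M N : 'M[R]_2) i j :
  (M * N) i j = M i 0 * N 0 j + M i 1 * N 1 j.
Proof. exact: mulmx2E. Qed.

Lemma det2E (R : comPzRingType) (M : 'M[R]_2) :
  \det M = M 0 0 * M 1 1 - M 0 1 * M 1 0.
Proof.
rewrite (expand_det_row _ 0) sum_ord2 /cofactor !det_mx11 !mxE /=.
rewrite (_ : lift 0 0 = 1 :> 'I_2); last exact/val_inj.
rewrite (_ : lift 1 0 = 0 :> 'I_2); last exact/val_inj.
by rewrite expr0 mul1r expr1 mulN1r mulrN.
Qed.

Lemma inv2E (R : comUnitRingType) (M : 'M[R]_2) : \det M = 1 ->
  [/\ M^-1 0 0 = M 1 1, M^-1 0 1 = - M 0 1,
      M^-1 1 0 = - M 1 0 & M^-1 1 1 = M 0 0].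
Proof.
move=> M1; pose N : 'M[R]_2 := \matrix_(i, j)
  if i == j then M (if i == 0 then 1 else 0) (if i == 0 then 1 else 0)
  else - M i j.
suff -> : M^-1 = N by rewrite !mxE.
have NM : N * M = 1.
  rewrite det2E in M1.
  apply/matrixP; apply: forall_ord2; apply: forall_ord2;
    rewrite mul2E !mxE /= -?M1; ring.
have uM : M \is a GRing.unit by rewrite unitmxE M1 unitr1.
by rewrite -[LHS]mul1r -NM mulrK.
Qed.

(** * Norms on SL(2, R) and the most contracted direction *)

Section Norms.
Variable R : realType.
Implicit Types (M N g h : 'M[R]_2) (v : 'cV[R]_2).

Lemma frob_ge0 M : 0 <= frob M. Proof. exact: sqrtr_ge0. Qed.

Lemma eucl_ge0 v : 0 <= eucl_norm v. Proof. exact: sqrtr_ge0. Qed.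

Lemma frob_sqr M :
  frob M ^+ 2 = M 0 0 ^+ 2 + M 0 1 ^+ 2 + M 1 0 ^+ 2 + M 1 1 ^+ 2.
Proof.
rewrite /frob sqr_sqrtr; last by do 2![apply: sumr_ge0 => ? _]; exact: sqr_ge0.
by rewrite !sum_ord2 addrA.
Qed.

Lemma eucl_sqr v : eucl_norm v ^+ 2 = v 0 0 ^+ 2 + v 1 0 ^+ 2.
Proof.
rewrite /eucl_norm sqr_sqrtr; last by apply: sumr_ge0 => ? _; exact: sqr_ge0.
by rewrite sum_ord2.
Qed.

Lemma ler_of_sqr (x y : R) : 0 <= y -> x ^+ 2 <= y ^+ 2 -> x <= y.
Proof. by move=> y0 xy; rewrite leNgt; apply/negP => yx; nra. Qed.

(** Lagrange's identity: the Cauchy-Schwarz defect for row [i] of [M] and column [j] of [N] is the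
    square of [M i 0 * N 1 j - M i 1 * N 0 j]. *)
Lemma frobM M N : frob (M * N) <= frob M * frob N.
Proof.
apply: ler_of_sqr; first by rewrite mulr_ge0 ?frob_ge0.
rewrite exprMn !frob_sqr !mul2E -subr_ge0.
set d := (X in 0 <= X).
have -> : d = (M 0 0 * N 1 0 - M 0 1 * N 0 0) ^+ 2
   + (M 0 0 * N 1 1 - M 0 1 * N 0 1) ^+ 2
   + (M 1 0 * N 1 0 - M 1 1 * N 0 0) ^+ 2
   + (M 1 0 * N 1 1 - M 1 1 * N 0 1) ^+ 2 by rewrite /d; ring.
by rewrite !addr_ge0 ?sqr_ge0.
Qed.

Lemma eucl_mulmx_le M v : eucl_norm (M *m v) <= frob M * eucl_norm v.
Proof.
apply: ler_of_sqr; first by rewrite mulr_ge0 ?frob_ge0 ?eucl_ge0.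
rewrite exprMn frob_sqr !eucl_sqr !mulmx2E -subr_ge0.
set d := (X in 0 <= X).
have -> : d = (M 0 0 * v 1 0 - M 0 1 * v 0 0) ^+ 2
   + (M 1 0 * v 1 0 - M 1 1 * v 0 0) ^+ 2 by rewrite /d; ring.
by rewrite !addr_ge0 ?sqr_ge0.
Qed.

Lemma eucl_eq0 v : eucl_norm v = 0 -> v = 0.
Proof.
move=> v0; have := eucl_sqr v; rewrite v0 => v2.
have [z0 z1] : v 0 0 = 0 /\ v 1 0 = 0 by split; nra.
apply/matrixP; apply: forall_ord2 => j; rewrite ord1 mxE//.
Qed.

Lemma eucl_gt0 v : v != 0 -> 0 < eucl_norm v.
Proof.
move=> v0; rewrite lt_neqAle eucl_ge0 andbT eq_sym.
by apply: contraNneq v0 => /eucl_eq0 ->.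
Qed.

Lemma euclZ (c : R) v : eucl_norm (c *: v) = `|c| * eucl_norm v.
Proof.
rewrite /eucl_norm -sqrtr_sqr -sqrtrM ?sqr_ge0// !sum_ord2 !mxE.
by congr Num.sqrt; ring.
Qed.

(** [|M|^2 - 2 det M] is the sum of the squares of [M 0 0 - M 1 1] and [M 0 1 + M 1 0]. *)
Lemma frob_ge1 M : \det M = 1 -> 1 <= frob M.
Proof.
rewrite det2E => M1; apply: ler_of_sqr (frob_ge0 M) _.
rewrite frob_sqr expr1n.
have := sqr_ge0 (M 0 0 - M 1 1); have := sqr_ge0 (M 0 1 + M 1 0); nra.
Qed.

Lemma frobV M : \det M = 1 -> frob M^-1 = frob M.
Proof.
move=> /inv2E [e00 e01 e10 e11]; apply/eqP; rewrite -(@eqrXn2 _ 2)// ?frob_ge0//.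
by rewrite !frob_sqr e00 e01 e10 e11; apply/eqP; ring.
Qed.

Lemma eucl_ge_frob M v : \det M = 1 ->
  eucl_norm v / frob M <= eucl_norm (M *m v).
Proof.
move=> M1; have M0 : 0 < frob M by exact: lt_le_trans (frob_ge1 M1).
rewrite ler_pdivrMr// mulrC -(frobV M1) -[X in eucl_norm X <= _]mul1mx.
have uM : M \in unitmx by rewrite unitmxE M1 unitr1.
by rewrite -(mulVmx uM) -mulmxA; exact: eucl_mulmx_le.
Qed.

Lemma normr_entry_frob M i j : `|M i j| <= frob M.
Proof.
rewrite -sqrtr_sqr ler_wsqrtr// !sum_ord2.
have := (sqr_ge0 (M 0 0), sqr_ge0 (M 0 1), sqr_ge0 (M 1 0), sqr_ge0 (M 1 1)).
move=> [[[? ?] ?] ?].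
by elim/forall_ord2: i; elim/forall_ord2: j; lra.
Qed.

Lemma frob_le_entries M c : (forall i j, `|M i j| <= c) -> frob M <= 2 * c.
Proof.
move=> Mc; have c0 : 0 <= c by exact: le_trans (Mc 0 0).
apply: ler_of_sqr; first by rewrite mulr_ge0.
have e i j : M i j ^+ 2 <= c ^+ 2.
  by rewrite -real_normK ?num_real// ler_pXn2r ?nnegrE.
rewrite frob_sqr exprMn.
have := (e 0 0, e 0 1, e 1 0, e 1 1) => -[[[? ?] ?] ?]; lra.
Qed.

Lemma frobD_le M N : frob (M + N) <= 2 * (frob M + frob N).
Proof.
apply: frob_le_entries => i j; rewrite mxE (le_trans (ler_normD _ _))//.
by rewrite lerD ?normr_entry_frob.
Qed.

Lemma eucl_col_le M j : eucl_norm (col j M) <= frob M.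
Proof.
apply: ler_of_sqr (frob_ge0 M) _; rewrite eucl_sqr frob_sqr !mxE.
have := (sqr_ge0 (M 0 0), sqr_ge0 (M 0 1), sqr_ge0 (M 1 0), sqr_ge0 (M 1 1)).
move=> [[[? ?] ?] ?].
by elim/forall_ord2: j; lra.
Qed.

Let unit_images M : set R :=
  [set eucl_norm (M *m v) | v in [set v | eucl_norm v = 1]].

Let unit_images_ub M : ubound (unit_images M) (frob M).
Proof.
by move=> _ [v /= v1 <-]; rewrite -[leRHS]mulr1 -v1 eucl_mulmx_le.
Qed.

Lemma eucl_delta (j : 'I_2) : eucl_norm (delta_mx j 0 : 'cV[R]_2) = 1.
Proof.
apply/eqP; rewrite -(@eqrXn2 _ 2)// ?eucl_ge0// eucl_sqr !mxE.
by apply/eqP; elim/forall_ord2: j; rewrite /=; ring.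
Qed.

Lemma op_norm_le_frob M : op_norm M <= frob M.
Proof.
apply: ge_sup; last exact: unit_images_ub.
by exists (eucl_norm (M *m delta_mx 0 0)), (delta_mx 0 0) => //=; exact: eucl_delta.
Qed.

Lemma frob_le_op_norm M : frob M <= 2 * op_norm M.
Proof.
apply: frob_le_entries => i j.
apply: (@le_trans _ _ (eucl_norm (M *m delta_mx j 0))).
  rewrite -colE -sqrtr_sqr ler_wsqrtr// sum_ord2 !mxE.
  by elim/forall_ord2: i; rewrite ?lerDl ?lerDr sqr_ge0.
apply: ub_le_sup; first by exists (frob M); exact: unit_images_ub.
by exists (delta_mx j 0) => //=; exact: eucl_delta.
Qed.

Lemma wedge_le (v w : 'cV[R]_2) :
  `|v 0 0 * w 1 0 - v 1 0 * w 0 0| <= eucl_norm v * eucl_norm w.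
Proof.
apply: ler_of_sqr; first by rewrite mulr_ge0 ?eucl_ge0.
rewrite real_normK ?num_real// exprMn !eucl_sqr.
have := sqr_ge0 (v 0 0 * w 0 0 + v 1 0 * w 1 0); nra.
Qed.

(** Preservation of area; with [wedge_le], decay of one vector forces growth of every vector
    independent of it. *)
Lemma wedge_mulmx M (v w : 'cV[R]_2) : \det M = 1 ->
  (M *m v) 0 0 * (M *m w) 1 0 - (M *m v) 1 0 * (M *m w) 0 0 =
  v 0 0 * w 1 0 - v 1 0 * w 0 0.
Proof.
by rewrite det2E => M1; rewrite !mulmx2E -[RHS]mul1r -M1; ring.
Qed.

(* Up to O(|g|^-4), the orthogonal projection onto the direction most contracted
   by g: its eigenvalues are 1 - s^2/|g|^2 for the singular values s of g.  Using
   it instead of a contracted unit vector avoids any choice of signs. *)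
Definition contr_proj g : 'M[R]_2 := 1 - (frob g ^- 2) *: (g^T * g).

Lemma contr_projE g i j : contr_proj g i j =
  (i == j)%:R - (g 0 i * g 0 j + g 1 i * g 1 j) / frob g ^+ 2.
Proof. by rewrite !mxE sum_ord2 !mxE mulrC. Qed.

(** Trace 1 survives a limit, so a limit of such matrices is nonzero. *)
Lemma contr_proj_trace g : \det g = 1 ->
  contr_proj g 0 0 + contr_proj g 1 1 = 1.
Proof.
move=> g1; have g0 : frob g != 0 by rewrite gt_eqF// (lt_le_trans ltr01)// frob_ge1.
rewrite !contr_projE /= addrACA -opprD -mulrDl.
rewrite (_ : _ + _ + (_ + _) = frob g ^+ 2); last by rewrite frob_sqr; ring.
by rewrite divff ?expf_neq0//; ring.
Qed.

(** By Cayley-Hamilton, [|g|^2 - g^T g] is the adjugate of [g^T g], that is, its inverse; hence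
    [g * contr_proj g] is the transpose of [g^-1] divided by [|g|^2]. *)
Lemma frob_contr g : \det g = 1 -> frob (g * contr_proj g) = (frob g)^-1.
Proof.
move=> g1; have g0 : 0 < frob g by rewrite (lt_le_trans ltr01)// frob_ge1.
have t0 : g 0 0 ^+ 2 + g 0 1 ^+ 2 + g 1 0 ^+ 2 + g 1 1 ^+ 2 != 0.
  by rewrite -frob_sqr expf_neq0// gt_eqF.
apply/eqP; rewrite -(@eqrXn2 _ 2)// ?frob_ge0 ?invr_ge0 ?frob_ge0//.
rewrite frob_sqr !mul2E !contr_projE exprVn frob_sqr /=; apply/eqP.
(* The identity becomes homogeneous, and holds for all entries, once 1 is written as [(det g)^2]. *)
have D : (g 0 0 * g 1 1 - g 0 1 * g 1 0) ^+ 2 = 1 by rewrite -det2E g1 expr1n.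
rewrite -[RHS]mul1r; apply: etrans (congr1 (fun x => x * _) D); field.
exact: t0.
Qed.

(* For symmetric X, Y of size 2, tr (X Y) = tr X tr Y - tr (adj X Y); applied to
   the two normalized Gram matrices, this gives
   |P_h - P_g|^2 = 2 |h g^-1|^2 / (|g| |h|)^2 - 2 / |g|^4 - 2 / |h|^4. *)
Lemma contr_proj_step g h : \det g = 1 -> \det h = 1 ->
  frob (contr_proj h - contr_proj g) <=
  2 * frob (h * g^-1) / (frob g * frob h).
Proof.
move=> g1 h1.
have g0 : 0 < frob g by rewrite (lt_le_trans ltr01)// frob_ge1.
have h0 : 0 < frob h by rewrite (lt_le_trans ltr01)// frob_ge1.
apply: ler_of_sqr; first by rewrite divr_ge0 ?mulr_ge0 ?frob_ge0.
rewrite frob_sqr !expr_div_n !exprMn.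
set t := frob g ^+ 2; set s := frob h ^+ 2.
have t0 : 0 < t by rewrite exprn_gt0.
have s0 : 0 < s by rewrite exprn_gt0.
rewrite -(ler_pM2r (_ : 0 < (t * s) ^+ 2)); last by rewrite exprn_gt0 ?mulr_gt0.
have E i j : (contr_proj h - contr_proj g) i j =
  ((g 0 i * g 0 j + g 1 i * g 1 j) * s - (h 0 i * h 0 j + h 1 i * h 1 j) * t)
    / (t * s).
  rewrite !mxE !sum_ord2 !mxE -/s -/t; field; by rewrite !gt_eqF.
rewrite !E !expr_div_n -!mulrDl divfK; last by rewrite expf_neq0// gt_eqF ?mulr_gt0.
rewrite (_ : _ / (t * s) * _ = 2 ^+ 2 * frob (h * g^-1) ^+ 2 * (t * s)); last first.
  by field; rewrite !gt_eqF.
have [e00 e01 e10 e11] := inv2E g1.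
rewrite frob_sqr !mul2E e00 e01 e10 e11.
(* By the identity above, this is the gap between the two sides; keeping the determinants symbolic
   makes it a polynomial identity. *)
have D : 0 <= 2 * s ^+ 2 * \det g ^+ 2 + 2 * t ^+ 2 * \det h ^+ 2
   + 2 * (t * s) * frob (h * g^-1) ^+ 2.
  by rewrite g1 h1 !expr1n !mulr1 !addr_ge0 ?mulr_ge0 ?sqr_ge0
    ?(ltW t0) ?(ltW s0) ?ler0n ?frob_ge0.
rewrite -subr_ge0; apply: le_trans D _.
rewrite le_eqVlt; apply/orP; left; apply/eqP.
by rewrite frob_sqr !mul2E e00 e01 e10 e11 !det2E /t /s !frob_sqr; ring.
Qed.

End Norms.

(** * Linear growth rates of real sequences *)

Section Growth.
Variable R : realType.
Implicit Types (x y : nat -> R) (L : R).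

(** [x n = L n + o(n)], with an error bound valid for every [n], so that such bounds can be added
    without tracking thresholds. *)
Definition growth x L : Prop :=
  forall e, 0 < e -> exists C, forall n, `|x n - L * n%:R| <= e * n%:R + C.

Lemma norm_sub_div (a L t : R) : 0 < t -> `|L - a / t| * t = `|a - L * t|.
Proof.
by move=> t0; rewrite -[X in _ * X]gtr0_norm// -normrM mulrBl divfK ?gt_eqF// distrC.
Qed.

(** The threshold depends only on [C] and [e], not on [a] or [L]; this is the source of the
    uniformity in the theorem. *)
Lemma near_div_natr (C e : R) : 0 < e -> \forall n \near \oo,
  forall (a L : R), `|a - L * n%:R| <= e / 2 * n%:R + C -> `|L - a / n%:R| < e.
Proof.
move=> e0; near=> n => a L aL.
have n0 : 0 < n%:R :> R by near: n; exact: nbhs_infty_gtr.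
have Cn : 2 * C / e < n%:R by near: n; exact: nbhs_infty_gtr.
rewrite -(ltr_pM2r n0) norm_sub_div//; apply: le_lt_trans aL _.
by move: Cn; rewrite ltr_pdivrMr//; nra.
Unshelve. all: by end_near. Qed.

Lemma growthP x L : x n / n%:R @[n --> \oo] --> L <-> growth x L.
Proof.
split=> [/cvgrPdist_le xL e e0|xL].
  have [n0 _ n0P] := xL _ e0.
  (* The constant absorbs the errors up to [n0] included, so that [n > 0] in the remaining case. *)
  exists (\sum_(i < n0.+1) `|x i - L * i%:R|) => n.
  have S0 : 0 <= \sum_(i < n0.+1) `|x i - L * i%:R| by exact: sumr_ge0.
  have [nn0|n0n] := ltnP n n0.+1.
    rewrite (bigD1 (Ordinal nn0))//= addrCA lerDl addr_ge0 ?sumr_ge0//.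
    by rewrite mulr_ge0// ltW.
  have n_gt0 : 0 < n%:R :> R by rewrite ltr0n (leq_ltn_trans _ n0n).
  have := n0P n (ltnW n0n); rewrite -(ler_pM2r n_gt0) norm_sub_div//.
  move=> /le_trans; apply.
  by rewrite lerDl.
apply/cvgrPdist_lt => e e0; have [C xC] := xL (e / 2) (divr_gt0 e0 (ltr0n _ 2)).
near=> n; have : `|x n - L * n%:R| <= e / 2 * n%:R + C by [].
by near: n; apply: filterS (near_div_natr C e0) => n; exact.
Unshelve. all: by end_near. Qed.

Lemma growth_perturb x y L (D : R) : (forall n, `|y n - x n| <= D) ->
  growth x L -> growth y L.
Proof.
move=> yx xL e /xL[C xC]; exists (C + D) => n.
rewrite -(subrKA (x n)) (le_trans (ler_normD _ _))//.
by rewrite addrA [leRHS]addrC lerD.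
Qed.

(** With [D (1 - q) = C], the envelopes [x n + D q^n] and [x n - D q^n] are monotone and enclose a
    common limit, which gives the rate too. *)
Lemma geometric_steps_cvg x (C q : R) : 0 <= q -> q < 1 ->
  (forall n, `|x n.+1 - x n| <= C * q ^+ n) ->
  cvgn x /\ forall n, `|limn x - x n| <= C / (1 - q) * q ^+ n.
Proof.
move=> q0 q1 xC; set D := C / (1 - q).
have DE : C = D - D * q by rewrite /D; field; rewrite gt_eqF// subr_gt0.
have q0n n : 0 <= q ^+ n by rewrite exprn_ge0.
have C0 : 0 <= C by have := le_trans (normr_ge0 _) (xC 0%N); rewrite expr0 mulr1.
have D0 : 0 <= D by rewrite divr_ge0// subr_ge0 ltW.
pose u n := x n + D * q ^+ n; pose l n := x n - D * q ^+ n.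
have u_dec : {homo u : n m / (n <= m)%N >-> m <= n}.
  apply/nonincreasing_seqP => n; rewrite /u exprS.
  by have := xC n; rewrite ler_norml {1 2}DE => /andP[_]; nra.
have l_inc : {homo l : n m / (n <= m)%N >-> n <= m}.
  apply/nondecreasing_seqP => n; rewrite /l exprS.
  by have := xC n; rewrite ler_norml {1 2}DE => /andP[+ _]; nra.
have Dq0 : D * q ^+ n @[n --> \oo] --> 0.
  by apply: cvg_geometric; rewrite ger0_norm.
have u_cvg : cvgn u.
  apply: nonincreasing_is_cvgn => //; exists (l 0%N) => _ [n _ <-].
  apply: le_trans (l_inc 0%N n (leq0n n)) _; rewrite /l /u.
  by have := mulr_ge0 D0 (q0n n); lra.
have x_cvg : x @ \oo --> limn u.
  rewrite (_ : x = fun n => u n - D * q ^+ n); last first.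
    by apply/funext => n; rewrite /u addrK.
  by rewrite -[limn u]subr0; exact: cvgB.
have l_cvg : l @ \oo --> limn u by rewrite -[limn u]subr0; exact: cvgB.
split=> [|n]; [exact: cvgP x_cvg | rewrite (cvg_lim _ x_cvg)//].
have /= u_n := nonincreasing_cvgn_ge u_dec u_cvg n.
have /= l_n := nondecreasing_cvgn_le l_inc (cvgP _ l_cvg) n.
rewrite (cvg_lim _ l_cvg)// in l_n.
by rewrite ler_norml; move: u_n l_n; rewrite /u /l; lra.
Qed.

Lemma ln_le_expR (a b : R) : 0 < a -> (ln a <= b) = (a <= expR b).
Proof. by move=> a0; rewrite -[b in LHS]expRK ler_ln ?posrE ?expR_gt0. Qed.

Lemma growth_expR_bounds x L (e : R) : growth (fun n => ln (x n)) L ->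
  (forall n, 0 < x n) -> 0 < e -> exists2 C, 0 < C & forall n,
  x n <= C * expR (L + e) ^+ n /\ (x n)^-1 <= C * expR (e - L) ^+ n.
Proof.
move=> xL x0 /xL[C xC]; exists (expR C); rewrite ?expR_gt0// => n.
rewrite -!expRM_natl -!expRD -!ln_le_expR ?invr_gt0// lnV ?posrE//.
by have := xC n; rewrite ler_norml => /andP[]; lra.
Qed.

End Growth.

(** * The direction contracted by a one-sided sequence *)

(** The projections [P n] move by at most [2 K / (|g n| |g n.+1|)], about [e^(-2 L n)], so they
    converge to some [Q] at that rate. Both terms of [g Q = g P + g (Q - P)] are then about
    [e^(-L n)], and a nonzero column of [Q] is the vector sought. The matching lower bound is
    [|v| / |g n|]. *)
Lemma contracted_vector (R : realType) (g : nat -> 'M[R]_2) (K L : R) :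
  (forall n, \det (g n) = 1) -> (forall n, frob (g n.+1 * (g n)^-1) <= K) ->
  0 < L -> growth (fun n => ln (frob (g n))) L ->
  exists2 v : 'cV[R]_2, v != 0 & growth (fun n => ln (eucl_norm (g n *m v))) (- L).
Proof.
move=> g1 gK L0 gL.
have fg n : 0 < frob (g n) by rewrite (lt_le_trans ltr01)// frob_ge1.
have K0 : 0 <= K by exact: le_trans (frob_ge0 _) (gK 0%N).
pose P n := contr_proj (g n).
have P_cvg e : 0 < e -> e < L -> exists2 D, 0 < D & forall i j,
    cvgn (fun n => P n i j) /\
    forall n, `|limn (fun n => P n i j) - P n i j| <= D * expR (e - L) ^+ n ^+ 2.
  move=> e0 eL; have [C C0 gC] := growth_expR_bounds gL fg e0.
  have q1 : expR (e - L) < 1 by rewrite expR_lt1 subr_lt0.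
  have q21 : expR (e - L) ^+ 2 < 1 by rewrite exprn_ilt1 ?expR_ge0.
  (* The geometric series constant; the [+ 1] makes it positive. *)
  exists (2 * K * C ^+ 2 * expR (e - L) / (1 - expR (e - L) ^+ 2) + 1).
    rewrite ltr_wpDl// divr_ge0//; last by rewrite subr_ge0 ltW.
    by rewrite !mulr_ge0 ?expR_ge0 ?sqr_ge0 ?exprn_ge0 ?(ltW C0).
  move=> i j.
  have step n : `|P n.+1 i j - P n i j| <=
      2 * K * C ^+ 2 * expR (e - L) * (expR (e - L) ^+ 2) ^+ n.
    have -> : P n.+1 i j - P n i j = (P n.+1 - P n) i j by rewrite !mxE.
    rewrite (le_trans (normr_entry_frob _ _ _))//.
    rewrite (le_trans (contr_proj_step (g1 n) (g1 n.+1)))// invfM.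
    rewrite (_ : 2 * K * _ * _ * _ = 2 * K * ((C * expR (e - L) ^+ n) *
      (C * expR (e - L) ^+ n.+1))); last by rewrite exprAC [_ ^+ n.+1]exprS; ring.
    rewrite ler_pM ?mulr_ge0 ?invr_ge0 ?frob_ge0 ?ler_wpM2l ?gK//.
    by rewrite ler_pM ?invr_ge0 ?frob_ge0 ?(gC n).2 ?(gC n.+1).2.
  have [cP limP] := geometric_steps_cvg (sqr_ge0 _) q21 step.
  split=> // n; rewrite (le_trans (limP n))// -!exprM mulnC.
  by rewrite ler_wpM2r ?exprn_ge0 ?expR_ge0// lerDl.
pose Q : 'M[R]_2 := \matrix_(i, j) limn (fun n => P n i j).
have [j Qj] : exists j, col j Q != 0.
  have [D _ cP] := P_cvg (L / 2) ltac:(lra) ltac:(lra).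
  apply/not_existsP => Q0.
  have Qjj j : Q j j = 0.
    by have /negP/negPn/eqP/matrixP/(_ j 0) := Q0 j; rewrite !mxE.
  have : limn (fun n => P n 0 0 + P n 1 1) = 0.
    rewrite limD; [|exact: (cP _ _).1..].
    by have := (Qjj 0, Qjj 1); rewrite !mxE => -[-> ->]; rewrite addr0.
  rewrite (_ : (fun n => _) = fun=> 1); last first.
    by apply/funext => n; exact: contr_proj_trace.
  by rewrite lim_cst//; apply/eqP; rewrite oner_eq0.
exists (col j Q) => // e e0.
(* In [g (Q - P)] the factor [g] loses [d] in the exponent and the squared rate loses [2 * d], in
   all at most [e]; [d < L] is needed for convergence. *)
pose d := Num.min (e / 3) (L / 2).
have d0 : 0 < d by rewrite lt_min !divr_gt0.
have dL : d < L by rewrite gt_min; apply/orP; right; lra.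
have de : d <= e / 3 by rewrite ge_min lexx.
have gv n : 0 < eucl_norm (g n *m col j Q).
  by apply: lt_le_trans (eucl_ge_frob _ (g1 n)); rewrite divr_gt0 ?eucl_gt0.
have [D D0 PD] := P_cvg d d0 dL.
have [C C0 gC] := growth_expR_bounds gL fg d0.
have up n : eucl_norm (g n *m col j Q) <=
    (2 * (C + C * (2 * D))) * expR (3 * d - L) ^+ n.
  rewrite (_ : g n *m col j Q = col j (g n * Q)); last first.
    by apply/matrixP => a b; rewrite mulmx2E !mxE sum_ord2 !mxE.
  rewrite (le_trans (eucl_col_le _ _))//.
  have -> : g n * Q = g n * P n + g n * (Q - P n)
    by rewrite -mulrDr [P n + _]addrC subrK.
  rewrite (le_trans (frobD_le _ _))// -mulrA ler_wpM2l// mulrDl lerD//.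
    rewrite frob_contr// (le_trans (gC n).2)// ler_wpM2l ?(ltW C0)//.
    by rewrite lerXn2r ?nnegrE ?expR_ge0// ler_expR; lra.
  rewrite (le_trans (frobM _ _))//.
  have -> : C * (2 * D) * expR (3 * d - L) ^+ n =
      (C * expR (L + d) ^+ n) * (2 * (D * expR (d - L) ^+ n ^+ 2)).
    rewrite -!expRM_natl (_ : n%:R * (3 * d - L) =
      n%:R * (L + d) + 2 * (n%:R * (d - L))); last by ring.
    by rewrite !expRD; ring.
  rewrite ler_pM ?frob_ge0 ?(gC n).1//; apply: frob_le_entries => a b.
  by rewrite mxE [Q a b]mxE [(- P n) a b]mxE; exact: (PD a b).2.
have v0 := eucl_gt0 Qj.
exists (`|ln (2 * (C + C * (2 * D)))| + `|ln C| + `|ln (eucl_norm (col j Q))|) => n.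
have n0 : 0 <= n%:R :> R by [].
have : ln (eucl_norm (g n *m col j Q)) <=
    ln (2 * (C + C * (2 * D))) + n%:R * (3 * d - L).
  rewrite ln_le_expR// expRD expRM_natl lnK ?up// posrE.
  by rewrite mulr_gt0// addr_gt0// !mulr_gt0.
have : ln (eucl_norm (col j Q)) - ln C - n%:R * (L + d) <=
    ln (eucl_norm (g n *m col j Q)).
  have := eucl_ge_frob (col j Q) (g1 n).
  rewrite -ler_ln ?posrE ?divr_gt0//.
  rewrite ln_div ?posrE//; apply: le_trans.
  rewrite -addrA -opprD lerD2l lerN2 ln_le_expR// expRD expRM_natl lnK ?posrE//.
  exact: (gC n).1.
have := (ler_norm (ln (2 * (C + C * (2 * D)))), ler_norm (ln C)).
have := lerNnormlW (lexx `|ln (eucl_norm (col j Q))|).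
have := (normr_ge0 (ln (2 * (C + C * (2 * D)))), normr_ge0 (ln C)).
have := normr_ge0 (ln (eucl_norm (col j Q))).
rewrite ler_norml; move=> ? [? ?] ? [? ?] ? ?; nra.
Qed.

(** * Two-sided sequences, modelling the cocycle along a leading sequence *)

Lemma int_natP (q : int) : exists n : nat, q = n%:Z \/ q = - n%:Z.
Proof. by exists `|q|%N; lia. Qed.

Section TwoSided.
Variables (R : realType) (f : int -> 'M[R]_2) (K L : R).
Hypothesis f1 : forall q, \det (f q) = 1.
Hypothesis fK : forall q, frob (f (q + 1) * (f q)^-1) <= K.
Hypothesis growth_pos : growth (fun n => ln (frob (f n%:Z))) L.
Hypothesis growth_neg : growth (fun n => ln (frob (f (- n%:Z)))) L.
Hypothesis not_both_contracted : 0 < L -> forall v : 'cV[R]_2, v != 0 ->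
  growth (fun n => ln (eucl_norm (f n%:Z *m v))) (- L) ->
  growth (fun n => ln (eucl_norm (f (- n%:Z) *m v))) (- L) -> False.

Let f_unit q : f q \is a GRing.unit.
Proof. by rewrite unitmxE f1 unitr1. Qed.

Let fV1 q p : \det (f q * (f p)^-1) = 1.
Proof. by rewrite detM detV !f1 invr1 mulr1. Qed.

Let ln_frob_ge0 q : 0 <= ln (frob (f q)).
Proof. by rewrite ln_ge0// frob_ge1. Qed.

Let frob_gt0 (g : 'M[R]_2) : \det g = 1 -> 0 < frob g.
Proof. by move=> g1; rewrite (lt_le_trans ltr01)// frob_ge1. Qed.

Let eucl_f_gt0 q (v : 'cV[R]_2) : v != 0 -> 0 < eucl_norm (f q *m v).
Proof.
move=> v0; apply: lt_le_trans (eucl_ge_frob _ (f1 q)).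
by rewrite divr_gt0 ?eucl_gt0 ?frob_gt0.
Qed.

Lemma growth_ln_frob_ge0 : 0 <= L.
Proof.
have /growthP fL := growth_pos.
rewrite -(cvg_lim (@Rhausdorff R) fL); apply: limr_ge; first exact: cvgP fL.
by near=> n; rewrite divr_ge0.
Unshelve. all: by end_near. Qed.

Lemma ln_frob_int_le e : 0 < e -> exists C, forall q,
  ln (frob (f q)) <= (L + e) * `|q|%:R + C.
Proof.
move=> e0; have [C1 C1P] := growth_pos e0; have [C2 C2P] := growth_neg e0.
exists (`|C1| + `|C2|) => q.
have := (normr_ge0 C1, normr_ge0 C2) => -[? ?].
have := (ler_norm C1, ler_norm C2) => -[? ?].
have [n [->|->]] := int_natP q.
- by have := C1P n; rewrite absz_nat ler_norml => /andP[_]; lra.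
- by have := C2P n; rewrite abszN absz_nat ler_norml => /andP[_]; lra.
Qed.

(** The vector is the one contracted at -oo. It is independent of the one contracted at +oo, and the
    constant area they span turns the decay of the latter into growth of the former. *)
Lemma exists_growing_vector : 0 < L -> exists2 v : 'cV[R]_2, v != 0 &
  growth (fun n => ln (eucl_norm (f (- n%:Z) *m v))) (- L) /\
  forall e, 0 < e -> exists C, forall n,
    (L - e) * n%:R - C <= ln (eucl_norm (f n%:Z *m v)).
Proof.
move=> L0.
have [|v v0 fv] := contracted_vector (fun n => f1 n%:Z) _ L0 growth_pos (K := K).
  by move=> n; have := fK n; rewrite (_ : n%:Z + 1 = n.+1); last lia.
have [|w w0 fw] := contracted_vector (fun n => f1 (- n%:Z)) _ L0 growth_neg (K := K).
  (* A backward step is the inverse of a forward step, of equal Frobenius norm. *)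
  move=> n; rewrite -frobV//.
  rewrite invrM ?invrK ?unitrV ?f_unit//.
  by have := fK (- n.+1%:Z); rewrite (_ : - n.+1%:Z + 1 = - n%:Z); last lia.
exists w => //; split=> // e e0.
pose d := v 0 0 * w 1 0 - v 1 0 * w 0 0.
have d0 : 0 < `|d|.
  (* Were the two vectors parallel, [v] would be contracted at both ends. *)
  rewrite normr_gt0; apply/eqP => d0.
  have [c vc] : exists c, v = c *: w.
    have [w00|w00] := eqVneq (w 0 0) 0.
      have w10 : w 1 0 != 0.
        apply: contraNneq w0 => w10.
        by apply/eqP/matrixP; apply: forall_ord2 => j; rewrite ord1 mxE.
      exists (v 1 0 / w 1 0); apply/matrixP; apply: forall_ord2 => j;
        rewrite ord1 mxE ?divfK// w00 mulr0.
      by move/eqP: d0; rewrite /d w00 mulr0 subr0 mulf_eq0 (negbTE w10) orbF => /eqP.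
    exists (v 0 0 / w 0 0); apply/matrixP; apply: forall_ord2 => j;
      rewrite ord1 mxE ?divfK// mulrAC; apply: (canRL (mulfK w00)).
    by move: d0; rewrite /d => /eqP; rewrite subr_eq0 => /eqP <-.
  have c0 : c != 0 by apply: contraNneq v0 => c0; rewrite vc c0 scale0r.
  apply: (not_both_contracted L0 v0 fv);
  apply: (growth_perturb (D := `|ln `|c| |)) fw => n.
  rewrite vc -scalemxAr euclZ lnM ?posrE ?normr_gt0 ?eucl_f_gt0//.
  by rewrite addrK.
have [C CP] := fv _ e0.
exists (C - ln `|d|) => n.
have : ln `|d| <= ln (eucl_norm (f n%:Z *m v)) + ln (eucl_norm (f n%:Z *m w)).
  rewrite -lnM ?posrE ?eucl_f_gt0// ler_ln ?posrE ?mulr_gt0 ?eucl_f_gt0//.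
  by rewrite /d -(wedge_mulmx _ _ (f1 n)) wedge_le.
by have := CP n; rewrite ler_norml => /andP[_]; lra.
Qed.

(** The point is that [C] does not depend on [p]: the two constraints place the window within a
    bounded distance of the origin. *)
Lemma growth_windows (N : nat) e : 0 < e -> exists C, forall (n : nat) (p : int),
  p <= N%:Z + 1 -> - N%:Z <= n%:Z + p ->
  `|ln (frob (f (n%:Z + p) * (f p)^-1)) - L * n%:R| <= e * n%:R + C.
Proof.
move=> e0; have L0 := growth_ln_frob_ge0.
have [C CP] := ln_frob_int_le e0.
(* The excess is largest when the window lies on one side of the origin: [2 p <= 2 N + 2] on the
   right, [-2 (n + p) <= 2 N] on the left. *)
have window n p : p <= N%:Z + 1 -> - N%:Z <= n%:Z + p ->
    `|(n%:Z + p)%R|%:R + `|p|%:R <= n%:R + (2 * N + 2)%:R :> R.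
  by move=> pN qN; rewrite -!natrD ler_nat; lia.
suff [D DP] : exists D, forall n p, p <= N%:Z + 1 -> - N%:Z <= n%:Z + p ->
    L * n%:R - e * n%:R - D <= ln (frob (f (n%:Z + p) * (f p)^-1)).
  exists (`|D| + `|(L + e) * (2 * N + 2)%:R + 2 * C|) => n p pN qN.
  have := (normr_ge0 D, normr_ge0 ((L + e) * (2 * N + 2)%:R + 2 * C)) => -[? ?].
  have := (ler_norm D, ler_norm ((L + e) * (2 * N + 2)%:R + 2 * C)) => -[? ?].
  have := DP n p pN qN.
  have := window n p pN qN; rewrite -(ler_pM2l (ltr_wpDl L0 e0)).
  have : ln (frob (f (n%:Z + p) * (f p)^-1)) <=
      ln (frob (f (n%:Z + p))) + ln (frob (f p)).
    rewrite -lnM ?posrE ?frob_gt0// ler_ln ?posrE ?mulr_gt0 ?frob_gt0//.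
    by rewrite (le_trans (frobM _ _))// frobV.
  have := (CP (n%:Z + p), CP p) => -[].
  by rewrite ler_norml; lra.
have [L_gt0|L_le0] := ltP 0 L; last first.
  exists 0 => n p _ _; have := ln_ge0 (frob_ge1 (fV1 (n%:Z + p) p)).
  have -> : L = 0 by lra.
  by have := mulr_ge0 (ltW e0) (ler0n R n); lra.
have [v v0 [v_neg v_pos]] := exists_growing_vector L_gt0.
have [C1 C1P] := v_neg _ e0; have [C2 C2P] := v_pos _ e0.
pose D := `|C1| + `|C2| + `|C| + `|ln (eucl_norm v)|.
have [DC1 DC2 DCv DvC] :
    [/\ C1 <= D, C2 <= D, C - ln (eucl_norm v) <= D & C + ln (eucl_norm v) <= D].
  have := (normr_ge0 C, normr_ge0 C1, normr_ge0 C2, normr_ge0 (ln (eucl_norm v))).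
  have := (ler_norm C, ler_norm C1, ler_norm C2, ler_norm (ln (eucl_norm v))).
  have := lerNnormlW (lexx `|ln (eucl_norm v)|).
  by rewrite /D => ? [[[? ?] ?] ?] [[[? ?] ?] ?]; split; lra.
(* [lo] and [hi] carry the signed exponent [L q], so their difference at [n + p] and [p] is [L n]
   for either sign of [p]. The half-line not covered by [C1P] or [C2P] follows from the norm of
   [f]. *)
have lo q : L * q%:~R - e * `|q|%:R - D <= ln (eucl_norm (f q *m v)).
  have [n [->|->]] := int_natP q.
    by rewrite absz_nat -pmulrn; have := C2P n; lra.
  rewrite mulrNz -pmulrn abszN absz_nat.
  have : ln (eucl_norm v) - ln (frob (f (- n%:Z))) <=
      ln (eucl_norm (f (- n%:Z) *m v)).
    rewrite -ln_div ?posrE ?eucl_gt0 ?frob_gt0// ler_ln ?posrE ?eucl_f_gt0//.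
      exact: eucl_ge_frob.
    by rewrite divr_gt0 ?eucl_gt0 ?frob_gt0.
  by have := CP (- n%:Z); rewrite abszN absz_nat; lra.
have hi p : ln (eucl_norm (f p *m v)) <= L * p%:~R + e * `|p|%:R + D.
  have [n [->|->]] := int_natP p; last first.
    rewrite mulrNz -pmulrn abszN absz_nat.
    by have := C1P n; rewrite ler_norml => /andP[_]; lra.
  rewrite absz_nat -pmulrn.
  have : ln (eucl_norm (f n%:Z *m v)) <= ln (frob (f n%:Z)) + ln (eucl_norm v).
    rewrite -lnM ?posrE ?eucl_gt0 ?frob_gt0//.
    rewrite ler_ln ?posrE ?mulr_gt0 ?eucl_f_gt0 ?eucl_gt0 ?frob_gt0//.
    exact: eucl_mulmx_le.
  by have := CP n%:Z; rewrite absz_nat; lra.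
exists (2 * D + e * (2 * N + 2)%:R) => n p pN qN.
have : ln (eucl_norm (f (n%:Z + p) *m v)) <=
    ln (frob (f (n%:Z + p) * (f p)^-1)) + ln (eucl_norm (f p *m v)).
  rewrite -lnM ?posrE ?frob_gt0 ?eucl_f_gt0//.
  rewrite ler_ln ?posrE ?mulr_gt0 ?frob_gt0 ?eucl_f_gt0//.
  rewrite -[in leLHS](mulrVK (f_unit p) (f (n%:Z + p))) -[_ *m v]mulmxA.
  exact: eucl_mulmx_le.
have := window n p pN qN; rewrite -(ler_pM2l e0).
by have := (hi p, lo (n%:Z + p)); rewrite intrD -pmulrn => -[]; lra.
Qed.

End TwoSided.

(** * The cocycle identity over the integers *)

Section Cocycles.
Variables (R : realType) (A : finType) (Om : subshift A) (M : Om -> 'M[R]_2).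
Implicit Type w : Om.

Lemma seq_of_Tpow (k i : int) w : seq_of (Tpow k w) i = seq_of w (i + k).
Proof. by []. Qed.

Lemma TpowD (k l : int) w : Tpow k (Tpow l w) = Tpow (k + l) w.
Proof.
apply/val_inj/funext => n; rewrite /= /shiftz /=; congr (seq_of w _).
exact: esym (addrA _ _ _).
Qed.

Lemma cocycle0 w : cocycle M 0 w = 1.
Proof. exact: big_ord0. Qed.

Lemma cocycle_posS n w :
  cocycle M n.+1%:Z w = M (Tpow n%:Z w) * cocycle M n%:Z w.
Proof.
by rewrite /= big_ord_recl /= subn1.
Qed.

Lemma cocycle_negS n w : cocycle M (- n.+1%:Z) w =
  (M (Tpow (- n.+1%:Z) w))^-1 * cocycle M (- n%:Z) w.
Proof.
(* At [n = 0] the right-hand cocycle is the empty product of the [Posz] branch. *)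
rewrite -NegzE; case: n => [|n]; first by rewrite /= big_ord1 big_ord0 mulr1.
by rewrite -!NegzE /= big_ord_recl.
Qed.

Hypothesis M1 : SL2_valued M.

Lemma cocycleS (q : int) w :
  cocycle M (q + 1) w = M (Tpow q w) * cocycle M q w.
Proof.
have [[|n] [->|->]] := int_natP q.
- exact: cocycle_posS.
- exact: cocycle_posS.
- by rewrite -(cocycle_posS n.+1) -PoszD addn1.
- rewrite cocycle_negS mulVKr ?unitmxE ?M1 ?unitr1//.
  by congr (cocycle M _ w); lia.
Qed.

Lemma det_cocycle (q : int) w : \det (cocycle M q w) = 1.
Proof.
have [n [->|->]] := int_natP q; elim: n => [|n IHn].
- by rewrite cocycle0 det1.
- by rewrite cocycle_posS detM M1 IHn mulr1.
- by rewrite cocycle0 det1.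
- by rewrite cocycle_negS detM detV M1 invr1 IHn mulr1.
Qed.

(** Puts the cocycle over a window in the form treated by [growth_windows]. *)
Lemma cocycle_Tpow (n : nat) (p : int) w :
  cocycle M n%:Z (Tpow p w) = cocycle M (n%:Z + p) w * (cocycle M p w)^-1.
Proof.
have uM q : cocycle M q w \is a GRing.unit by rewrite unitmxE det_cocycle unitr1.
elim: n => [|n IHn]; first by rewrite cocycle0 add0r divrr.
rewrite cocycle_posS IHn TpowD mulrA -cocycleS.
by congr (cocycle M _ w * _); lia.
Qed.

Lemma eq_cocycle (n : nat) w w' :
  (forall i, (i < n)%N -> M (Tpow i%:Z w) = M (Tpow i%:Z w')) ->
  cocycle M n%:Z w = cocycle M n%:Z w'.
Proof. by move=> ww'; apply: eq_bigr => i _; exact: ww'. Qed.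

End Cocycles.

(** * Consequences of local constancy and of (alpha) *)

Section LocallyConstant.
Variables (R : realType) (A : finType) (Om : subshift A) (M : Om -> 'M[R]_2).
Hypothesis M_loc : locally_constant M.

(** [M w] depends only on a word of length [2 N + 1], and there are finitely many; words that do not
    occur get the value 0. *)
Lemma locally_constant_frob_bounded : exists K, forall w, frob (M w) <= K.
Proof.
have [N MN] := M_loc.
pose F (u : (2 * N + 1).-tuple A) : R :=
  if pselect (exists w : Om, word (seq_of w) (- N%:Z) (2 * N + 1) = u) is left e
  then frob (M (projT1 (cid e))) else 0.
exists (\sum_u `|F u|) => w; pose u := word (seq_of w) (- N%:Z) (2 * N + 1).
have Fu : F u = frob (M w).
  rewrite /F; case: pselect => [e|]; last by case; exists w.
  congr (frob _); apply: MN => i iN; case: cid => v /= vu.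
  have lt_iN : (`|(i + N%:Z)%R|%N < 2 * N + 1)%N by lia.
  have := congr1 (fun t => tnth t (Ordinal lt_iN)) vu.
  rewrite !tnth_mktuple /= => vw.
  by have -> : i = - N%:Z + `|(i + N%:Z)%R|%N%:Z by lia.
by rewrite -Fu (bigD1 u)//= (le_trans (ler_norm _))// lerDl sumr_ge0.
Qed.

(** The [n] factors of the cocycle are determined by the word of length [n + 2 N] starting at [-N],
    which (alpha) finds in a leading sequence. *)
Lemma cocycle_in_leading_window (r : nat) (lead : 'I_r -> Om) :
  leading_sequence_condition R lead ->
  exists N n0 : nat, forall n w, (n0 <= n)%N ->
  exists j p, [/\ p <= N%:Z + 1, - N%:Z <= n%:Z + p &
    cocycle M n%:Z w = cocycle M n%:Z (Tpow p (lead j))].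
Proof.
move=> [[n0 langP] _ _]; have [N MN] := M_loc; exists N, n0 => n w n0n.
have : language Om (n + 2 * N) (word (seq_of w) (- N%:Z) (n + 2 * N)).
  by exists w, (- N%:Z).
rewrite langP; last by rewrite (leq_trans n0n)// leq_addr.
(* The copy starts at [-k + 1]; the window starts [N] letters later, past the left margin. *)
move=> [j _ [k /= kn kw]]; exists j, (- k%:Z + 1 + N%:Z); split; [lia|lia|].
apply: eq_cocycle => i lt_in; apply: MN => t tN.
rewrite !seq_of_Tpow.
have lt_s : (`|(t + i%:Z + N%:Z)%R|%N < n + 2 * N)%N by lia.
have := congr1 (fun t => tnth t (Ordinal lt_s)) kw.
rewrite !tnth_mktuple /= => E.
have -> : t + i%:Z = - N%:Z + `|(t + i%:Z + N%:Z)%R|%N%:Z by lia.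
rewrite -E; congr (seq_of _ _); lia.
Qed.

End LocallyConstant.

(** * From leading sequences to the whole subshift *)

Lemma ln_frob_op_norm (R : realType) (g : 'M[R]_2) : \det g = 1 ->
  `|ln (frob g) - ln (op_norm g)| <= ln 2.
Proof.
move=> g1; have f0 : 0 < frob g by rewrite (lt_le_trans ltr01)// frob_ge1.
have fo := frob_le_op_norm g; have opf := op_norm_le_frob g.
have o0 : 0 < op_norm g by rewrite -(pmulr_rgt0 _ (ltr0n R 2)) (lt_le_trans f0).
rewrite -ler_ln ?posrE ?mulr_gt0// lnM ?posrE// in fo.
rewrite -ler_ln ?posrE// in opf.
by rewrite ger0_norm ?subr_ge0// lerBlDr.
Qed.

Lemma uniform_cvg_to_cst (R : realType) (X : choiceType) (F : nat -> X -> R)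
    (L : R) :
  (forall e, 0 < e -> \forall n \near \oo, forall x, `|L - F n x| < e) ->
  {uniform, F @ \oo --> (fun=> L)}.
Proof.
move=> FL P /uniform_nbhs[E [+ EP]].
rewrite -entourage_ballE => -[e /= e0 eE].
near=> n; apply: EP => x _; apply: eE => /=; rewrite -ball_normE /=.
by move: x; near: n; exact: FL.
Unshelve. all: by end_near. Qed.

Theorem theorem2p5 (R : realType) (A : finType) (Om : subshift A)
    (hmin : minimal Om) (hue : uniquely_ergodic R Om) (hlsc : LSC R Om)
    (M : Om -> 'M[R]_2) (hSL : SL2_valued M) (hloc : locally_constant M) :
  uniform_cocycle M.
Proof.
have [r [lead lsc]] := hlsc.
have [L limL] := LSC_beta lsc hSL hloc.
have [K MK] := locally_constant_frob_bounded hloc.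
have [N [n0 window]] := cocycle_in_leading_window hloc lsc.
have growth_lead j e : 0 < e -> exists C, forall n p,
    p <= N%:Z + 1 -> - N%:Z <= n%:Z + p ->
    `|ln (frob (cocycle M n%:Z (Tpow p (lead j)))) - L * n%:R| <= e * n%:R + C.
  have frob_growth (q : nat -> int) :
      ln (op_norm (cocycle M (q n) (lead j))) / n%:R @[n --> \oo] --> L ->
      growth (fun n => ln (frob (cocycle M (q n) (lead j)))) L.
    move=> /growthP; apply: (growth_perturb (D := ln 2)) => n.
    by rewrite ln_frob_op_norm// det_cocycle.
  move=> e0; have [] := @growth_windows R (fun q => cocycle M q (lead j)) K L
    _ _ (frob_growth _ (limL j).1) (frob_growth _ (limL j).2) _ N e e0.
  - by move=> q; exact: det_cocycle.
  - move=> q; rewrite cocycleS// mulrK; first exact: MK.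
    by rewrite unitmxE det_cocycle// unitr1.
  (* For [L > 0] both rates would be [- L < 0], against (gamma). *)
  - move=> L0 v v0 /growthP pos /growthP neg.
    apply: (LSC_gamma lsc hSL hloc (j := j) v0).
    by exists (- L), (- L); rewrite oppr_lt0.
  move=> C CP; exists C => n p pN qN.
  by rewrite cocycle_Tpow//; exact: CP.
exists L; apply: uniform_cvg_to_cst => e e0.
have [C CP] := choice (fun j => growth_lead j (e / 2) (divr_gt0 e0 (ltr0n _ 2))).
(* One constant for the finitely many leading sequences, with [ln 2] for the change of norm; [n] can
   thus be fixed before [w]. *)
pose D := \sum_j `|C j| + ln 2.
near=> n => w.
have near_n : forall a l : R,
  `|a - l * n%:R| <= e / 2 * n%:R + D -> `|l - a / n%:R| < e.
  by near: n; exact: near_div_natr.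
have nn0 : (n0 <= n)%N by near: n; exact: nbhs_infty_ge.
have [j [p [pN qN cE]]] := window n w nn0.
apply: near_n; have := ln_frob_op_norm (det_cocycle hSL n%:Z w).
  have := CP j n p pN qN; rewrite -cE.
  have CD : C j + ln 2 <= D.
    by rewrite lerD2r (bigD1 j)//= (le_trans (ler_norm _))// lerDl sumr_ge0.
  by rewrite !ler_norml => /andP[? ?] /andP[? ?]; apply/andP; split; lra.
Unshelve. all: by end_near. Qed.
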